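(* Let $\{p_n\}_{n\ge 0}$ and $\{q_n\}_{n\ge 0}$ be sequences of positive real numbers and let $1<k\le s<\infty$. Let $k^{*}$ be the conjugate index of $k$, i.e. $1/k+1/k^{*}=1$. Then $|\overline{N},p_n|_k \Rightarrow |\overline{N},q_n|_s$ (every series summable $|\overline{N},p_n|_k$ is summable $|\overline{N},q_n|_s$) if and only if both of the following hold: (i) $$n^{1/k-1/s}\,\frac{q_nP_n}{p_nQ_n}=O(1)\qquad (n\ge 1),$$ and (ii) $$\left(\sum_{n=m+1}^{\infty}\left(n^{1-1/s}\frac{q_n}{Q_nQ_{n-1}}\right)^{s}\right)^{1/s}\left(\sum_{v=1}^{m}\left|Q_v-\frac{q_vP_v}{p_v}\right|^{k^{*}}\frac1v\right)^{1/k^{*}}=O(1)\qquad (m\ge 1).$$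
   Context: For positive sequences $\{p_n\}_{n\ge0}$, $\{q_n\}_{n\ge 0}$ put $P_n=\sum_{i=0}^n p_i$ and $Q_n=\sum_{i=0}^n q_i$. Given a series $\sum_{n\ge 0} a_n$ with partial sums $s_n=\sum_{i=0}^n a_i$, the $n$th term of its $(\overline{N},p_n)$ (weighted mean) transform is $T_n=\frac1{P_n}\sum_{i=0}^n p_i s_i$. For $k>1$, the series $\sum a_n$ is called summable $|\overline{N},p_n|_k$ if $\sum_{n=1}^\infty n^{k-1}|\Delta T_n|^k<\infty$, where $\Delta T_n=T_n-T_{n-1}$. Summability $|\overline{N},q_n|_s$ is defined in the same way with $q_n$, $Q_n$, $s$ in place of $p_n$, $P_n$, $k$. The notation $|\overline{N},p_n|_k\Rightarrow|\overline{N},q_n|_s$ means that every series summable $|\overline{N},p_n|_k$ is summable $|\overline{N},q_n|_s$. A condition ''$=O(1)$'' means the quantity is finite and bounded by a constant uniformly in the indicated free index. *)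

(* Defs.v *)
From HB Require Import structures.
From mathcomp Require Import all_boot all_order all_algebra.
From mathcomp Require Import all_classical all_reals all_analysis.

Set Implicit Arguments.
Unset Strict Implicit.
Unset Printing Implicit Defensive.

Import Order.TTheory GRing.Theory Num.Theory.

Local Open Scope ring_scope.

(* The sum includes the term of index [n], unlike the library's [series]. *)
Definition psum (R : realType) (u : nat -> R) (n : nat) : R :=
  \sum_(0 <= i < n.+1) u i.

Definition wmean (R : realType) (p a : nat -> R) (n : nat) : R :=
  (psum p n)^-1 * \sum_(0 <= i < n.+1) p i * psum a i.

(* [a] is the sequence of terms of the series. The sum of nonnegative terms
   is taken in the extended reals, so its convergence is its finiteness. *)
Definition wm_summable (R : realType) (p : nat -> R) (k : R) (a : nat -> R) :
    Prop :=
  (\sum_(1 <= n <oo)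
     (n%:R `^ (k - 1) * `|wmean p a n - wmean p a n.-1| `^ k)%:E < +oo)%E.

Definition wm_implies (R : realType) (p : nat -> R) (k : R)
    (q : nat -> R) (s : R) : Prop :=
  forall a : nat -> R, wm_summable p k a -> wm_summable q s a.

Definition diag_quantity (R : realType) (p q : nat -> R) (k s : R)
    (n : nat) : R :=
  n%:R `^ (k^-1 - s^-1) * ((q n * psum p n) / (p n * psum q n)).

Definition tail_factor (R : realType) (q : nat -> R) (s : R) (m : nat) :
    \bar R :=
  ((\sum_(m.+1 <= n <oo)
      ((n%:R `^ (1 - s^-1) * (q n / (psum q n * psum q n.-1))) `^ s)%:E)
     `^ s^-1)%E.

Definition head_factor (R : realType) (p q : nat -> R) (kstar : R)
    (m : nat) : R :=
  (\sum_(1 <= v < m.+1)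
     `|psum q v - q v * psum p v / p v| `^ kstar * v%:R^-1) `^ kstar^-1.

(* [tail_factor] may be [+oo]; the product in [\bar R] then follows the
   convention [+oo * 0 = 0]. This matters only when [head_factor] vanishes
   for every [m], that is when [q] is proportional to [p]: for [q = p] and
   [k = s] the implication is trivially true although the tail may diverge. *)
Definition product_quantity (R : realType) (p q : nat -> R) (kstar s : R)
    (m : nat) : \bar R :=
  (tail_factor q s m * (head_factor p q kstar m)%:E)%E.

(* Main.v *)
Require Import Defs.
From HB Require Import structures.
From mathcomp Require Import all_boot all_order all_algebra.
From mathcomp Require Import all_classical all_reals all_analysis.
From mathcomp Require Import ring lra.

Set Implicit Arguments.
Unset Strict Implicit.
Unset Printing Implicit Defensive.

Import Order.TTheory GRing.Theory Num.Theory.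

Local Open Scope ring_scope.

(** Write x_n and y_n for the increments of the two weighted means, P_n and
    Q_n for the partial sums of the weights, and c_v = Q_v - q_v P_v / p_v.
    Eliminating the series between the two transforms gives, for n >= 1,
      y_n = (q_n P_n) / (p_n Q_n) x_n
            + q_n / (Q_n Q_(n-1)) * (sum of c_v x_v over 1 <= v < n)
    ([dwmeanE]), and every sequence with x_0 = 0 is the sequence of increments
    of some series ([dwmean_surj]). After the substitutions
    X_n = n^(1-1/k) x_n and Y_n = n^(1-1/s) y_n the theorem says when a lower
    triangular matrix
      Y_n = d_n X_n + w_n * (sum of b_v X_v over v < n),   d, w >= 0,
    maps l^k into l^s: exactly when its diagonal d is bounded and its strictly
    triangular part satisfies the Muckenhoupt type condition of the second
    clause.

    Sufficiency ([triangular_sufficient]): the diagonal part is bounded because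
    l^k is contained in l^s, and the other part is a weighted discrete Hardy
    inequality ([hardy_sum]). The latter comes from Hoelder's inequality with
    the weight B_v^(1/(k k')), B_v being the partial sums of |b_v|^k', and
    three applications of Bernoulli's inequality to powers of partial sums.

    Necessity ([triangular_necessary]): no operator norm is assumed, so the
    bounds are extracted by a uniform boundedness principle for monotone
    homogeneous functionals of nonnegative sequences ([uniform_bound]), proved
    by superposing bad sequences. Choosing signs reduces to nonnegative
    sequences: the sign of X_n can be taken equal to that of the sum of the
    b_v X_v over v < n, so that the two terms of Y_n do not cancel
    ([triangular_diag]). This bounds d; subtracting the diagonal part leaves the
    Hardy part, which is tested on |b_v|^(k'/k) cut off at m. *)

(** * Powers of partial sums *)

Lemma gt0_powRD (R : realType) (x r t : R) :
  0 < x -> x `^ (r + t) = x `^ r * x `^ t.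
Proof. by move=> x0; rewrite powRD// (gt_eqF x0) implybT. Qed.

Lemma powRVK (R : realType) (x r : R) : 0 < r -> 0 <= x -> (x `^ r^-1) `^ r = x.
Proof. by move=> r0 x0; rewrite -powRrM mulVf ?gt_eqF// powRr1. Qed.

Lemma powRKV (R : realType) (x r : R) : 0 < r -> 0 <= x -> (x `^ r) `^ r^-1 = x.
Proof. by move=> r0 x0; rewrite -powRrM divff ?gt_eqF// powRr1. Qed.

Lemma powR_le (R : realType) (x y r : R) :
  0 <= r -> 0 <= x -> x <= y -> x `^ r <= y `^ r.
Proof.
by move=> r0 x0 xy; apply: ge0_ler_powR; rewrite ?nnegrE// (le_trans x0).
Qed.

(** Young's inequality for [a `^ th] and [b `^ (1 - th)], with the conjugate
    exponents 1/th and 1/(1-th), divided by [b `^ (1 - th)]. *)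
Lemma powR_le_tangent (R : realType) (th a b : R) :
  0 < th -> th <= 1 -> 0 <= a -> 0 < b ->
  a `^ th <= b `^ th + th * b `^ (th - 1) * (a - b).
Proof.
move=> th0 th1 a0 b0; have bge0 := ltW b0.
have [->|th_neq1] := eqVneq th 1.
  by rewrite subrr powRr0 !powRr1// !mul1r addrC subrK.
have th_lt1 : th < 1 by rewrite lt_neqAle th_neq1.
have := @conjugate_powR R (a `^ th) (b `^ (1 - th)) th^-1 (1 - th)^-1.
rewrite !powR_ge0 !invr_gt0 subr_gt0 !invrK subrKC -!powRrM.
rewrite !divff ?gt_eqF ?subr_gt0// !powRr1// => /(_ isT isT th0 th_lt1 erefl).
move=> /(ler_wpM2r (powR_ge0 b (th - 1))).
move=> h; rewrite -mulrA -gt0_powRD// in h.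
rewrite addrA subrK subrr powRr0 mulr1 in h.
apply: (le_trans h); rewrite -[in leRHS](mulr_powRB1 bge0 th0).
by rewrite le_eqVlt; apply/orP; left; apply/eqP; ring.
Qed.

(** The tangent inequality for the concave inverse power 1/r, taken between
    [a `^ r] and [b `^ r] and solved for [a `^ r]. *)
Lemma powR_ge_tangent (R : realType) (r a b : R) :
  1 <= r -> 0 <= a -> 0 < b ->
  b `^ r + r * b `^ (r - 1) * (a - b) <= a `^ r.
Proof.
move=> r1 a0 b0; have r0 : 0 < r by exact: lt_le_trans r1.
have := @powR_le_tangent R r^-1 (a `^ r) (b `^ r).
rewrite invr_gt0 r0 invf_le1// r1 powR_ge0 powR_gt0// -!powRrM.
rewrite [r * (_ - 1)]mulrBr mulr1 divff ?gt_eqF// !powRr1 ?(ltW b0)//.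
move=> /(_ isT isT isT isT).
have c0 : 0 < r * b `^ (r - 1) by rewrite mulr_gt0// powR_gt0.
rewrite -(ler_pM2l c0) => h; rewrite -subr_ge0 in h; rewrite -subr_ge0.
apply: le_trans h _; rewrite le_eqVlt; apply/orP; left; apply/eqP.
rewrite mulrDr.
have -> : r * b `^ (r - 1) * (r^-1 * b `^ (1 - r) * (a `^ r - b `^ r)) =
    (r / r) * (b `^ (r - 1) * b `^ (1 - r)) * (a `^ r - b `^ r) by ring.
rewrite divff ?gt_eqF// -gt0_powRD// addrA subrK subrr powRr0.
ring.
Qed.

Lemma powR_concave_step (R : realType) (th u U : R) :
  0 < th -> th <= 1 -> 0 <= u -> 0 <= U ->
  th * (u * (U + u) `^ (th - 1)) <= (U + u) `^ th - U `^ th.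
Proof.
move=> th0 th1 u0 U0; have := addr_ge0 U0 u0.
rewrite le_eqVlt => /predU1P[/esym/eqP|Uu0].
  rewrite paddr_eq0// => /andP[/eqP-> /eqP->].
  by rewrite addr0 mul0r mulr0 subrr.
have := powR_le_tangent th0 th1 U0 Uu0; lra.
Qed.

Lemma powR_convex_step (R : realType) (r u U : R) :
  1 <= r -> 0 <= u -> 0 <= U ->
  (U + u) `^ r - U `^ r <= r * (u * (U + u) `^ (r - 1)).
Proof.
move=> r1 u0 U0; have := addr_ge0 U0 u0.
rewrite le_eqVlt => /predU1P[/esym/eqP|Uu0].
  rewrite paddr_eq0// => /andP[/eqP-> /eqP->].
  by rewrite addr0 mul0r mulr0 subrr.
have := powR_ge_tangent r1 U0 Uu0; lra.
Qed.

(** Discrete counterpart of the integral of t^(th-1) over [0, U] being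
    U^th / th: by concavity each summand is at most an increment of the power
    of the partial sums, and the increments telescope. *)
Lemma sum_head_powR (R : realType) (th : R) (u : nat -> R) n :
  0 < th -> th <= 1 -> (forall i, 0 <= u i) ->
  th * (\sum_(0 <= v < n) u v * (\sum_(0 <= i < v.+1) u i) `^ (th - 1)) <=
  (\sum_(0 <= v < n) u v) `^ th.
Proof.
move=> th0 th1 u0; elim: n => [|n IH].
  by rewrite !big_nil mulr0 powR_ge0.
rewrite [X in th * X](big_nat_recr n)//= mulrDr.
have := @powR_concave_step R th (u n) (\sum_(0 <= v < n) u v) th0 th1 (u0 n).
rewrite -(big_nat_recr n)//= => /(_ (sumr_ge0 _ (fun i _ => u0 i))); lra.
Qed.

(** The same telescoping for sums over the tails, run downwards from [N]. *)
Lemma sum_tail_powR (R : realType) (th : R) (u : nat -> R) m N :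
  0 < th -> th <= 1 -> (forall i, 0 <= u i) ->
  th * (\sum_(m <= n < N) u n * (\sum_(n <= i < N) u i) `^ (th - 1)) <=
  (\sum_(m <= n < N) u n) `^ th.
Proof.
move=> th0 th1 u0; have [Nm|/ltnW mN] := leqP N m.
  by rewrite !big_geq// mulr0 powR_ge0.
rewrite -(subKn mN); move: (N - m)%N (leq_subr m N) => d; elim: d => [|d IH] dN.
  by rewrite subn0 !big_geq// mulr0 powR_ge0.
have {}IH := IH (ltnW dN).
have e : (N - d.+1).+1 = (N - d)%N by rewrite -subSn// subSS.
have lt : (N - d.+1 < N)%N by rewrite ltn_subrL (leq_trans _ dN).
rewrite (@big_ltn _ _ _ (N - d.+1))// e mulrDr.
have := @powR_concave_step R th (u (N - d.+1)%N)
  (\sum_(N - d <= n < N) u n) th0 th1 (u0 _).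
rewrite [X in X `^ (th - 1)]addrC [X in X `^ th - _]addrC -e.
rewrite -big_ltn// e => /(_ (sumr_ge0 _ (fun i _ => u0 i))); lra.
Qed.

(** Convex counterpart of [sum_head_powR]: here the increments of the power
    are dominated by the summands. *)
Lemma powR_sum_le (R : realType) (r : R) (u : nat -> R) n :
  1 <= r -> (forall i, 0 <= u i) ->
  (\sum_(0 <= v < n) u v) `^ r <=
  r * (\sum_(0 <= v < n) u v * (\sum_(0 <= i < v.+1) u i) `^ (r - 1)).
Proof.
move=> r1 u0; elim: n => [|n IH].
  by rewrite !big_nil mulr0 powR0// gt_eqF// (lt_le_trans _ r1).
rewrite [X in r * X](big_nat_recr n)//= mulrDr.
have := @powR_convex_step R r (u n) (\sum_(0 <= v < n) u v) r1 (u0 n).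
rewrite -(big_nat_recr n)//= => /(_ (sumr_ge0 _ (fun i _ => u0 i))); lra.
Qed.

(** Inductive step of [hoelder_sum], stated for abstract reals [A] and [B]. *)
Lemma hoelder_step (R : realType) (p q A B a b S : R) :
  0 < p -> 0 < q -> p^-1 + q^-1 = 1 ->
  0 <= A -> 0 <= B -> 0 <= a -> 0 <= b ->
  S <= A `^ p^-1 * B `^ q^-1 ->
  S + a * b <= (A + a `^ p) `^ p^-1 * (B + b `^ q) `^ q^-1.
Proof.
move=> p0 q0 pq A0 B0 a0 b0 hS.
have := @hoelder2 R (A `^ p^-1) a (B `^ q^-1) b p q (powR_ge0 _ _) a0
  (powR_ge0 _ _) b0 p0 q0 pq.
move: (powRVK p0 A0) (powRVK q0 B0) hS.
move: (A `^ p^-1) (B `^ q^-1) => al be -> -> hS.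
by apply: le_trans; rewrite lerD2r.
Qed.

(** Hoelder's inequality for finite sums, one term at a time from the
    inequality for pairs. *)
Lemma hoelder_sum (R : realType) (p q : R) (a b : nat -> R) n :
  0 < p -> 0 < q -> p^-1 + q^-1 = 1 ->
  (forall i, 0 <= a i) -> (forall i, 0 <= b i) ->
  \sum_(0 <= i < n) a i * b i <=
  (\sum_(0 <= i < n) a i `^ p) `^ p^-1 * (\sum_(0 <= i < n) b i `^ q) `^ q^-1.
Proof.
move=> p0 q0 pq a0 b0; elim: n => [|n IH].
  by rewrite !big_nil mulr_ge0// powR_ge0.
rewrite !(big_nat_recr n)//=; apply: hoelder_step => //.
  by apply: sumr_ge0 => i _; exact: powR_ge0.
by apply: sumr_ge0 => i _; exact: powR_ge0.
Qed.

(** * The discrete Hardy inequality *)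

Lemma exchange_triangle (R : realType) (f : nat -> nat -> R) N :
  \sum_(0 <= n < N) \sum_(0 <= v < n) f v n =
  \sum_(0 <= v < N) \sum_(v.+1 <= n < N) f v n.
Proof.
elim: N => [|N IH]; first by rewrite !big_nil.
rewrite [LHS]big_nat_recr//= IH [RHS]big_nat_recr//= [X in _ = _ + X]big_geq//.
rewrite addr0 -big_split/=.
rewrite !big_nat; apply: eq_bigr => v /andP[_ vN].
by rewrite [in RHS]big_nat_recr.
Qed.

(** As [c] is nondecreasing, each partial sum of [y * c] is at most [Z] times
    the last value of [c]; inserted in [powR_sum_le], this brings the power [r]
    onto [c]. It does the work of Minkowski's inequality in l^r. *)
Lemma weighted_sum_powR (R : realType) (r Z : R) (y c : nat -> R) n :
  1 <= r -> (forall v, 0 <= y v) -> (forall v, 0 <= c v) ->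
  {homo c : i j / (i <= j)%N >-> i <= j} -> \sum_(0 <= v < n) y v <= Z ->
  (\sum_(0 <= v < n) y v * c v) `^ r <=
  r * Z `^ (r - 1) * \sum_(0 <= v < n) y v * c v `^ r.
Proof.
move=> r1 y0 c0 cmono yZ; have r0 : 0 < r by exact: lt_le_trans r1.
have u0 v : 0 <= y v * c v by rewrite mulr_ge0.
apply: (le_trans (powR_sum_le n r1 u0)).
rewrite -mulrA ler_wpM2l ?(ltW r0)// mulr_sumr.
apply: ler_sum_nat => v /andP[_ vn].
have Z0 : 0 <= Z by apply: le_trans yZ; exact: sumr_ge0.
have U : \sum_(0 <= i < v.+1) y i * c i <= Z * c v.
  apply: (@le_trans _ _ (\sum_(0 <= i < v.+1) y i * c v)).
    by apply: ler_sum_nat => i /andP[_ iv]; rewrite ler_wpM2l// cmono.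
  rewrite -mulr_suml ler_wpM2r//; apply: le_trans yZ.
  by rewrite (big_cat_nat (leq0n v.+1) vn)//= lerDl sumr_ge0.
have U0 : 0 <= \sum_(0 <= i < v.+1) y i * c i by exact: sumr_ge0.
have r1' : 0 <= r - 1 by rewrite subr_ge0.
have := powR_le r1' U0 U; rewrite powRM// => h.
apply: (le_trans (ler_wpM2l (u0 v) h)).
by rewrite mulrCA -!mulrA mulr_powRB1.
Qed.

(** Hoelder's inequality for x_v B_v^(1/(k k')) and b_v B_v^(-1/(k k')). The
    k'-th powers of the latter are b_v^k' B_v^(1/k' - 1), whose sum
    [sum_head_powR] controls by the power 1/k' of the last B. Where B_v vanishes
    so does b_v. *)
Lemma hoelder_self_weight (R : realType) (k k' : R) (b x B : nat -> R) n :
  1 < k -> k^-1 + k'^-1 = 1 ->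
  (forall v, 0 <= b v) -> (forall v, 0 <= x v) ->
  (forall n, B n = \sum_(0 <= v < n) b v `^ k') ->
  \sum_(0 <= v < n) b v * x v <=
  (\sum_(0 <= v < n) x v `^ k * B v.+1 `^ k'^-1) `^ k^-1 *
  (k' * B n `^ k'^-1) `^ k'^-1.
Proof.
move=> k1 kk' b0 x0 BE.
have k0 : 0 < k by exact: lt_trans k1.
have B0 m : 0 <= B m by rewrite BE; apply: sumr_ge0 => i _; exact: powR_ge0.
have bB v : b v `^ k' <= B v.+1.
  by rewrite BE big_nat_recr//= -BE lerDr.
have k'0 : 0 < k'.
  by rewrite -invr_gt0 -(@ltrD2l _ k^-1) kk' addr0 invf_lt1.
have kt : k * k^-1 = 1 by rewrite divff ?gt_eqF.
have k't : k' * k'^-1 = 1 by rewrite divff ?gt_eqF.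
pose a' v := x v * B v.+1 `^ (k^-1 * k'^-1).
pose b' v := b v * B v.+1 `^ (- (k^-1 * k'^-1)).
have -> : \sum_(0 <= v < n) b v * x v = \sum_(0 <= v < n) a' v * b' v.
  apply: eq_bigr => v _; rewrite /a' /b'.
  have [Bv0|Bv0] := eqVneq (B v.+1) 0.
    have : b v `^ k' == 0.
      by rewrite eq_le powR_ge0 andbT -Bv0.
    by move=> /eqP/powR_eq0_eq0 ->; rewrite !mul0r mulr0.
  rewrite powRN mulrACA divff ?mulr1 1?mulrC//.
  by rewrite powR_eq0 (negbTE Bv0).
have a'0 v : 0 <= a' v by rewrite mulr_ge0// powR_ge0.
have b'0 v : 0 <= b' v by rewrite mulr_ge0// powR_ge0.
apply: (le_trans (hoelder_sum n k0 k'0 kk' a'0 b'0)).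
apply: ler_pM; rewrite ?powR_ge0//.
  rewrite le_eqVlt; apply/orP; left; apply/eqP; congr (_ `^ _).
  apply: eq_bigr => i _; rewrite /a' powRM ?powR_ge0// -powRrM.
  by congr (_ * _ `^ _); rewrite mulrAC [k^-1 * k]mulrC kt mul1r.
apply: powR_le; first by rewrite invr_ge0 ltW.
  by apply: sumr_ge0 => i _; exact: powR_ge0.
have k'V0 : 0 < k'^-1 by rewrite invr_gt0.
have k'V1 : k'^-1 <= 1 by rewrite -kk' lerDr invr_ge0 ltW.
have := @sum_head_powR R k'^-1 (fun v => b v `^ k') n k'V0 k'V1
  (fun i => powR_ge0 _ _).
rewrite -BE => /(ler_wpM2l (ltW k'0)).
rewrite mulrA k't mul1r; apply: le_trans.
apply: ler_sum_nat => i _; rewrite -BE /b' powRM ?powR_ge0// -powRrM.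
rewrite ler_wpM2l ?powR_ge0// le_eqVlt; apply/orP; left; apply/eqP.
congr (_ `^ _); rewrite mulNr -mulrA [k'^-1 * k']mulrC k't mulr1.
by rewrite -kk' opprD addrCA subrr addr0.
Qed.

(** The hypothesis [W * B `^ E <= K] trades a power of [B] for the negative
    power of the tail [W] that [sum_tail_powR] can sum. *)
Lemma tail_weight (R : realType) (om W B E K t : R) :
  0 <= om -> om <= W -> 0 <= B -> 0 <= t -> W * B `^ E <= K ->
  om * B `^ (E * t) <= K `^ t * (om * W `^ (- t)).
Proof.
move=> om0 omW B0 t0 hK.
have [->|omN0] := eqVneq om 0; first by rewrite !mul0r mulr0.
have W0 : 0 < W by apply: lt_le_trans omW; rewrite lt_def omN0.
rewrite mulrCA ler_wpM2l// powRN ler_pdivlMr ?powR_gt0// powRrM mulrC.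
rewrite -powRM ?powR_ge0 ?(ltW W0)//; apply: powR_le hK => //.
by rewrite mulr_ge0 ?powR_ge0// ltW.
Qed.

(** Bound for one row of the Hardy operator. In use [F] is the inner sum, [om]
    the s-th power of the row weight, [S] the sum of the x_v^k weighted by
    B_v^t', and [T] the bound for S^(s/k) given by [weighted_sum_powR]. *)
Lemma hardy_term (R : realType) (s t t' om F S T B W K Z k' : R) :
  0 < s -> 0 <= F -> 0 <= S -> 0 <= B -> 0 <= K -> 0 <= k' ->
  0 <= om -> F <= S `^ t * (k' * B `^ t') `^ t' ->
  S `^ (s * t) <= s * t * Z `^ (s * t - 1) * T ->
  om * B `^ (s * t' * t') <= K `^ t' * (om * W `^ (- t')) ->
  om * F `^ s <= k' `^ (s * t') * (s * t * Z `^ (s * t - 1)) * K `^ t' *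
                 (T * (om * W `^ (- t'))).
Proof.
move=> s0 F0 S0 B0 K0 k'0 om0 hF hS hB.
have := powR_le (ltW s0) F0 hF.
rewrite powRM ?powR_ge0// -(powRrM S) -(powRrM (k' * _)).
rewrite (@powRM _ k')// ?powR_ge0// -(powRrM B).
rewrite [t * s]mulrC [t' * s]mulrC [t' * (_ * _)]mulrC => hFs.
apply: (le_trans (ler_wpM2l om0 hFs)).
have := ler_pM (powR_ge0 _ _) (mulr_ge0 om0 (powR_ge0 _ _)) hS hB.
move=> /(ler_wpM2l (powR_ge0 k' (s * t'))).
move: (S `^ _) (k' `^ _) (B `^ _) (Z `^ _) (K `^ _) (W `^ _).
move=> a1 a2 a3 a4 a5 a6 h.
have -> : om * (a1 * (a2 * a3)) = a2 * (a1 * (om * a3)) by ring.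
by apply: (le_trans h); rewrite le_eqVlt; apply/orP; left; apply/eqP; ring.
Qed.

(** Bound for one column of the Hardy operator: the negative power of the tails
    introduced by [tail_weight] sums to a power of the tail at [v], which is
    compensated by the power of [B]. *)
Lemma hardy_tail (R : realType) (k t E K : R) (om W : nat -> R) (B : R) v N :
  0 < k -> t = k^-1 -> t <= 1 -> 0 <= B -> (forall n, 0 <= om n) ->
  (forall n, W n = \sum_(n <= i < N) om i) ->
  W v * B `^ E <= K ->
  B `^ (E * t) * (\sum_(v <= n < N) om n * W n `^ (t - 1)) <= k * K `^ t.
Proof.
move=> k0 tE t1 B0 om0 WE hK.
have t0 : 0 < t by rewrite tE invr_gt0.
have W0 : 0 <= W v by rewrite WE sumr_ge0.
have hW : \sum_(v <= n < N) om n * W n `^ (t - 1) <= k * W v `^ t.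
  have := sum_tail_powR v N t0 t1 om0; rewrite -WE => /(ler_wpM2l (ltW k0)).
  rewrite mulrA [k * t](_ : _ = 1) ?mul1r; last by rewrite tE divff ?gt_eqF.
  by apply: le_trans; apply: ler_sum_nat => n _; rewrite WE.
apply: (le_trans (ler_wpM2l (powR_ge0 _ _) hW)).
rewrite mulrCA ler_wpM2l ?(ltW k0)// powRrM -powRM ?powR_ge0//.
by rewrite mulrC; apply: powR_le hK; rewrite ?(ltW t0)// mulr_ge0 ?powR_ge0.
Qed.

(** Discrete Hardy inequality with weights, for 1 < k <= s. The rows are
    estimated by [hardy_term]; after exchanging the order of summation each
    column contributes x_v^k times a constant, by [hardy_tail]. All sums are
    finite and the constant does not depend on [N]. The left-hand side of the
    hypothesis has tails starting at [m] because the strict inequality v < n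
    makes [m] the first row that sees all the v < m. *)
Lemma hardy_sum (R : realType) (k s k' K : R) (b x w : nat -> R) N :
  1 < k -> k <= s -> k^-1 + k'^-1 = 1 -> 0 <= K ->
  (forall v, 0 <= b v) -> (forall v, 0 <= x v) -> (forall n, 0 <= w n) ->
  (forall m, (\sum_(m <= n < N) w n `^ s) *
     (\sum_(0 <= v < m) b v `^ k') `^ (s / k') <= K) ->
  \sum_(0 <= n < N) (w n * \sum_(0 <= v < n) b v * x v) `^ s <=
  s * k' `^ (s / k') * K * (\sum_(0 <= v < N) x v `^ k) `^ (s / k).
Proof.
move=> k1 ks kk' K0 b0 x0 w0 hK.
have k0 : 0 < k by exact: lt_trans k1.
have s0 : 0 < s by exact: lt_le_trans ks.
have [B BE] : exists B, forall n, B n = \sum_(0 <= v < n) b v `^ k'.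
  by eexists.
have [W WE] : exists W, forall n, W n = \sum_(n <= i < N) w i `^ s.
  by eexists.
have {}hK m : W m * B m `^ (s / k') <= K by rewrite BE WE.
have B0 n : 0 <= B n by rewrite BE; apply: sumr_ge0 => i _; exact: powR_ge0.
have Bmono m n : (m <= n)%N -> B m <= B n.
  move=> mn; rewrite !BE (big_cat_nat (leq0n m) mn)//= lerDl.
  by apply: sumr_ge0 => i _; exact: powR_ge0.
have hF n := hoelder_self_weight n k1 kk' b0 x0 BE.
have k'0 : 0 < k'.
  by rewrite -invr_gt0 -(@ltrD2l _ k^-1) kk' addr0 invf_lt1.
have t1 : k^-1 <= 1 by rewrite invf_le1// ltW.
have t'0 : 0 <= k'^-1 by rewrite invr_ge0 ltW.
have r1 : 1 <= s / k by rewrite ler_pdivlMr// mul1r.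
have kt : k^-1 * k = 1 by rewrite mulVf ?gt_eqF.
have [t tE] : exists t, t = k^-1 by eexists.
have [t' t'E] : exists t', t' = k'^-1 by eexists.
rewrite -tE -t'E in kk' hK hF t1 t'0 r1 kt *.
have tB : t - 1 = - t' by rewrite -kk' opprD addrA subrr add0r.
have [y yE] : exists y, forall v, y v = x v `^ k by eexists.
have y0 v : 0 <= y v by rewrite yE powR_ge0.
have [om omE] : exists om, forall n, om n = w n `^ s by eexists.
have om0 n : 0 <= om n by rewrite omE powR_ge0.
have {}WE n : W n = \sum_(n <= i < N) om i.
  by rewrite WE; apply: eq_bigr => i _; rewrite omE.
have [Z ZE] : exists Z, Z = \sum_(0 <= v < N) y v by eexists.
have Z0 : 0 <= Z by rewrite ZE sumr_ge0.
have -> : \sum_(0 <= v < N) x v `^ k = Z.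
  by rewrite ZE; apply: eq_bigr => v _; rewrite yE.
have [C CE] : exists C,
    C = k' `^ (s * t') * (s * t * Z `^ (s * t - 1)) * K `^ t' by eexists.
have C0 : 0 <= C.
  by rewrite CE !mulr_ge0 ?powR_ge0// ?(ltW s0)// tE invr_ge0 ltW.
have hn n : (n < N)%N -> (w n * \sum_(0 <= v < n) b v * x v) `^ s <=
    C * \sum_(0 <= v < n)
      y v * B v.+1 `^ (s * t' * t) * (om n * W n `^ (t - 1)).
  move=> nN; have F0 : 0 <= \sum_(0 <= v < n) b v * x v.
    by apply: sumr_ge0 => v _; rewrite mulr_ge0.
  rewrite powRM// -mulr_suml -omE tB CE.
  apply: (hardy_term (B := B n) (S := \sum_(0 <= v < n) y v * B v.+1 `^ t'))
    => //; rewrite ?(ltW k'0)//.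
  - by apply: sumr_ge0 => v _; rewrite mulr_ge0// powR_ge0.
  - apply: le_trans (hF n) _; rewrite le_eqVlt; apply/orP; left; apply/eqP.
    by congr (_ `^ _ * _); apply: eq_bigr => v _; rewrite yE.
  - apply: le_trans (weighted_sum_powR (Z := Z) r1 y0 _ _ _) _.
    + by move=> v; exact: powR_ge0.
    + by move=> i j ij; apply: powR_le => //; exact: Bmono.
    + rewrite ZE (big_cat_nat (leq0n n) (ltnW nN))//= lerDl.
      by apply: sumr_ge0.
    + rewrite le_eqVlt; apply/orP; left; apply/eqP; congr (_ * _).
      apply: eq_bigr => v _; rewrite -powRrM; congr (_ * _ `^ _); ring.
  - apply: tail_weight => //.
    by rewrite WE big_ltn// lerDl sumr_ge0.
apply: (@le_trans _ _ (C * \sum_(0 <= n < N) \sum_(0 <= v < n)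
    y v * B v.+1 `^ (s * t' * t) * (om n * W n `^ (t - 1)))).
  by rewrite mulr_sumr; apply: ler_sum_nat => n /andP[_ nN]; exact: hn.
rewrite exchange_triangle.
apply: (@le_trans _ _ (C * \sum_(0 <= v < N) y v * (k * K `^ t))).
  rewrite ler_wpM2l//; apply: ler_sum_nat => v _.
  rewrite -mulr_sumr -mulrA ler_wpM2l//.
  exact: hardy_tail k0 tE t1 (B0 _) om0 WE (hK _).
rewrite -mulr_suml -ZE.
have KK : K `^ t * K `^ t' = K.
  by rewrite -powRD ?kk' ?oner_eq0// powRr1.
have ZZ : Z * Z `^ (s * t - 1) = Z `^ (s * t).
  by rewrite mulr_powRB1// (lt_le_trans _ r1).
rewrite CE -ZZ -[in leRHS]KK.
move: (K `^ t) (K `^ t') (Z `^ _) (k' `^ _) => a1 a2 a3 a4.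
have -> : s * a4 * (a1 * a2) * (Z * a3) =
   s * (t * k) * a4 * (a1 * a2) * (Z * a3) by rewrite kt mulr1.
by rewrite le_eqVlt; apply/orP; left; apply/eqP; ring.
Qed.

(** * The spaces l^p and uniform boundedness *)

(** Bounded partial sums, which for nonnegative terms is convergence, keep all
    estimates within the reals. *)
Definition in_ell (R : realType) (p : R) (x : nat -> R) : Prop :=
  exists Z : R, forall N, \sum_(0 <= n < N) `|x n| `^ p <= Z.

Lemma in_ell_le (R : realType) (p : R) (x y : nat -> R) :
  0 <= p -> (forall n, `|x n| <= `|y n|) -> in_ell p y -> in_ell p x.
Proof.
move=> p0 xy [Z hZ]; exists Z => N; apply: le_trans (hZ N).
by apply: ler_sum_nat => n _; exact: powR_le.
Qed.

Lemma in_ellM (R : realType) (p M : R) (d x : nat -> R) :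
  0 <= p -> (forall n, `|d n| <= M) ->
  in_ell p x -> in_ell p (fun n => d n * x n).
Proof.
move=> p0 dM [Z hZ]; exists (M `^ p * Z) => N.
apply: le_trans (ler_wpM2l (powR_ge0 _ _) (hZ N)).
rewrite mulr_sumr; apply: ler_sum_nat => n _.
rewrite -powRM//; last exact: le_trans (dM n).
by apply: powR_le; rewrite // normrM ler_wpM2r.
Qed.

Lemma in_ellD (R : realType) (p : R) (x y : nat -> R) :
  0 <= p -> in_ell p x -> in_ell p y -> in_ell p (fun n => x n + y n).
Proof.
move=> p0 [Zx hx] [Zy hy]; exists (2 `^ p * (Zx + Zy)) => N.
apply: le_trans (ler_wpM2l (powR_ge0 _ _) (lerD (hx N) (hy N))).
rewrite -big_split mulr_sumr; apply: ler_sum_nat => n _ /=.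
have h (a b : R) : 0 <= a -> 0 <= b -> a <= b ->
    (a + b) `^ p <= 2 `^ p * (a `^ p + b `^ p).
  move=> a0 b0 ab; rewrite mulrDr -!powRM// ler_wpDl ?powR_ge0//.
  by apply: powR_le; rewrite ?addr_ge0// mulr_natl mulr2n lerD2r.
apply: (@le_trans _ _ ((`|x n| + `|y n|) `^ p)).
  by apply: powR_le; rewrite // ler_normD.
have [xy|/ltW yx] := lerP `|x n| `|y n|; first exact: h.
rewrite [`|x n| + _]addrC [`|x n| `^ p + _]addrC; exact: h.
Qed.

(** Every term of [`|x n| `^ k] is at most the bound [Z] of the partial sums,
    so the excess exponent s - k costs the factor [Z `^ ((s - k) / k)]. *)
Lemma in_ell_incl (R : realType) (k s : R) (x : nat -> R) :
  0 < k -> k <= s -> in_ell k x -> in_ell s x.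
Proof.
move=> k0 ks [Z hZ]; exists (Z * Z `^ ((s - k) / k)) => N.
apply: le_trans (ler_wpM2r (powR_ge0 _ _) (hZ N)).
rewrite mulr_suml; apply: ler_sum_nat => n _.
have xZ : `|x n| `^ k <= Z.
  apply: le_trans (hZ n.+1); rewrite big_nat_recr//= lerDr.
  by apply: sumr_ge0 => i _; exact: powR_ge0.
have -> : `|x n| `^ s = `|x n| `^ k * (`|x n| `^ k) `^ ((s - k) / k).
  have s0 : 0 < s by exact: lt_le_trans ks.
  rewrite -powRrM mulrCA divff ?gt_eqF// mulr1 -powRD ?subrKC//.
  by rewrite (gt_eqF s0).
rewrite ler_wpM2l ?powR_ge0//; apply: powR_le => //; rewrite ?powR_ge0//.
by rewrite divr_ge0 ?subr_ge0// ltW.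
Qed.

(** Countably many sequences in the unit ball of l^1 lie, up to the factors
    2^(j+1), below a single one: their sum with the weights 2^-(j+1). *)
Lemma superpose (R : realType) (u : nat -> nat -> R) :
  (forall j v, 0 <= u j v) -> (forall j N, \sum_(0 <= v < N) u j v <= 1) ->
  exists phi : nat -> R, [/\ forall v, 0 <= phi v,
    forall N, \sum_(0 <= v < N) phi v <= 1 &
    forall j v, u j v / (2 ^+ j.+1) <= phi v].
Proof.
move=> u0 u1.
have c0 j v : 0 <= u j v / (2 ^+ j.+1) by rewrite mulr_ge0.
have ce0 j v : (0 <= (u j v / (2 ^+ j.+1))%:E)%E by rewrite lee_fin.
have geo J : \sum_(0 <= j < J) (2 ^+ j.+1)^-1 <= 1 :> R.
  suff -> : \sum_(0 <= j < J) (2 ^+ j.+1)^-1 = 1 - (2 ^+ J)^-1 :> R.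
    by rewrite gerBl.
  elim: J => [|J IH]; first by rewrite big_nil expr0 invr1 subrr.
  rewrite big_nat_recr//= IH exprS invfM.
  by rewrite [X in 1 - X](_ : _ = 2^-1 * (2 ^+ J)^-1 + 2^-1 * (2 ^+ J)^-1); lra.
pose e v := (\sum_(0 <= j <oo) (u j v / (2 ^+ j.+1))%:E)%E.
have e0 v : (0 <= e v)%E by apply: nneseries_ge0 => j _ _; exact: ce0.
have sume N : (\sum_(0 <= v < N) e v <= 1%:E)%E.
  rewrite /e -(nneseries_sum_nat 0 N 0 (fun v j => ce0 j v)).
  apply: lime_le.
    by apply: is_cvg_nneseries => j _ _; apply: sume_ge0 => v _; exact: ce0.
  apply: nearW => J.
  rewrite (_ : (\sum_(0 <= j < J) _)%E =
    (\sum_(0 <= j < J) (\sum_(0 <= v < N) u j v) / (2 ^+ j.+1))%:E); last first.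
    rewrite -sumEFin; apply: eq_bigr => j _.
    by rewrite sumEFin mulr_suml.
  rewrite lee_fin; apply: le_trans (geo J); apply: ler_sum_nat => j _.
  by rewrite ler_piMl.
have fe v : e v \is a fin_num.
  rewrite ge0_fin_numE//; apply: le_lt_trans (ltry 1).
  apply: le_trans (sume v.+1); rewrite big_nat_recr//=.
  by rewrite leeDr// sume_ge0.
exists (fun v => fine (e v)); split.
- by move=> v; exact: fine_ge0.
- move=> N; rewrite -lee_fin -sumEFin; apply: le_trans (sume N).
  by rewrite le_eqVlt; apply/orP; left; apply/eqP; apply: eq_bigr => v _;
    rewrite fineK.
- move=> j v; rewrite -lee_fin fineK//.
  apply: le_trans (nneseries_lim_ge j.+1 (fun n _ _ => ce0 n v)).
  by rewrite big_nat_recr//= leeDr// sume_ge0.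
Qed.

(** Banach-Steinhaus for monotone homogeneous functionals. If the bounds fail,
    there are sequences in the unit ball of l^k with f j larger than j times any
    prescribed factor; superposing their k-th powers gives one sequence of l^k
    above fixed multiples of all of them, hence unbounded values, by
    monotonicity. *)
Lemma uniform_bound (R : realType) (I : Type) (k : R)
    (f : I -> (nat -> R) -> R) :
  0 < k ->
  (forall i x y, (forall v, 0 <= x v) -> (forall v, x v <= y v) ->
     f i x <= f i y) ->
  (forall i c x, 0 <= c -> f i (fun v => c * x v) = c * f i x) ->
  (forall x, (forall v, 0 <= x v) -> in_ell k x ->
     exists C, forall i, f i x <= C) ->
  exists C, forall i x, (forall v, 0 <= x v) ->
    (forall N, \sum_(0 <= v < N) x v `^ k <= 1) -> f i x <= C.
Proof.
move=> k0 fmono fZ fbnd; apply: contrapT => unb.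
have {}unb C : exists y : I * (nat -> R), [/\ forall v, 0 <= y.2 v,
    forall N, \sum_(0 <= v < N) y.2 v `^ k <= 1 & C < f y.1 y.2].
  apply: contrapT => h; apply: unb; exists C => i x x0 x1.
  by rewrite leNgt; apply/negP => fC; apply: h; exists (i, x).
pose th j : R := (2 ^+ j.+1)^-1 `^ k^-1.
have th0 j : 0 < th j by rewrite powR_gt0// invr_gt0.
have [g hg] := choice (fun j => unb (j%:R / th j)).
have := @superpose R (fun j v => (g j).2 v `^ k) (fun j v => powR_ge0 _ _)
  (fun j => let: And3 _ h _ := hg j in h).
move=> [phi [phi0 phi1 phiu]].
have kV0 : 0 <= k^-1 by rewrite invr_ge0 ltW.
have x0 v : 0 <= phi v `^ k^-1 by exact: powR_ge0.
have [|C hC] := fbnd (fun v => phi v `^ k^-1) x0.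
  exists 1 => N; apply: le_trans (phi1 N).
  rewrite le_eqVlt; apply/orP; left; apply/eqP; apply: eq_bigr => v _.
  by rewrite ger0_norm// powRVK.
have {}hC j : j%:R <= C.
  have [g0 _ gj] := hg j.
  apply: le_trans (hC (g j).1); rewrite ltr_pdivrMr// in gj.
  apply: (le_trans (ltW gj)); rewrite mulrC -fZ ?(ltW (th0 j))//.
  apply: fmono => v; first by rewrite mulr_ge0// ltW.
  have c0 : 0 <= (2 ^+ j.+1)^-1 :> R by rewrite invr_ge0 exprn_ge0.
  rewrite -[(g j).2 v](powRKV k0 (g0 v)) /th -powRM ?powR_ge0//.
  apply: powR_le => //; first by rewrite mulr_ge0 ?powR_ge0.
  by rewrite mulrC; exact: phiu.
have := hC (Num.bound `|C|).
by rewrite leNgt (le_lt_trans (ler_norm C))// archi_boundP.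
Qed.

Lemma powR_mul_le (R : realType) (s k' S T M : R) :
  0 < s -> 0 <= S -> 0 <= T -> S `^ s^-1 * T `^ k'^-1 <= M ->
  S * T `^ (s / k') <= M `^ s.
Proof.
move=> s0 S0 T0 /(powR_le (ltW s0) (mulr_ge0 (powR_ge0 _ _) (powR_ge0 _ _))).
by rewrite powRM ?powR_ge0// powRVK// -powRrM [k'^-1 * s]mulrC.
Qed.

(** * Triangular matrices from l^k to l^s *)

Lemma sum_cut (R : realType) (u : nat -> R) N M : (forall v, 0 <= u v) ->
  \sum_(0 <= v < N) (v < M)%:R * u v <= \sum_(0 <= v < M) u v.
Proof.
move=> u0; have [NM|/ltnW MN] := leqP N M.
  rewrite [leRHS](big_cat_nat (leq0n N) NM)/= ler_wpDr ?sumr_ge0//.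
  by apply: ler_sum_nat => v _; rewrite ler_piMl// lern1 leq_b1.
rewrite (big_cat_nat (leq0n M) MN)/= [X in _ + X]big_nat_cond.
rewrite [X in _ + X]big1 ?addr0.
  by apply: ler_sum_nat => v /andP[_ ->]; rewrite mul1r.
by move=> v /andP[/andP[Mv _] _]; rewrite ltnNge Mv mul0r.
Qed.

(** The diagonal part is a bounded multiple of a sequence of l^k, hence lies in
    l^s; the strictly triangular part is [hardy_sum] with a bound uniform in the
    truncation. *)
Lemma triangular_sufficient (R : realType) (k s k' : R) (d w b : nat -> R) :
  1 < k -> k <= s -> k^-1 + k'^-1 = 1 ->
  (forall n, 0 <= d n) -> (forall n, 0 <= w n) ->
  (exists M, forall n, d n <= M) ->
  (exists M, forall m N, (\sum_(m.+1 <= n < N) w n `^ s) `^ s^-1 *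
     (\sum_(0 <= v < m.+1) `|b v| `^ k') `^ k'^-1 <= M) ->
  forall x, in_ell k x ->
    in_ell s (fun n => d n * x n + w n * \sum_(0 <= v < n) b v * x v).
Proof.
move=> k1 ks kk' d0 w0 [Md hd] [M hM] x hx.
have k0 : 0 < k by exact: lt_trans k1.
have s0 : 0 < s by exact: lt_le_trans ks.
have k'0 : 0 < k'.
  by rewrite -invr_gt0 -(@ltrD2l _ k^-1) kk' addr0 invf_lt1.
apply: in_ellD; first exact: ltW.
  apply: (@in_ellM _ _ Md); [exact: ltW | by move=> n; rewrite ger0_norm |].
  exact: in_ell_incl hx.
have [Z hZ] := hx.
have M0 : 0 <= M by apply: le_trans (hM 0 0); rewrite mulr_ge0 ?powR_ge0.
have Z0 : 0 <= Z by apply: le_trans (hZ 0); rewrite big_nil.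
exists (s * k' `^ (s / k') * M `^ s * Z `^ (s / k)) => N.
have hK m : (\sum_(m <= n < N) w n `^ s) *
     (\sum_(0 <= v < m) `|b v| `^ k') `^ (s / k') <= M `^ s.
  case: m => [|m].
    rewrite [X in _ * X `^ _]big_nil powR0 ?mulr0 ?powR_ge0//.
    by rewrite gt_eqF// divr_gt0.
  have S0 : 0 <= \sum_(m.+1 <= n < N) w n `^ s.
    by apply: sumr_ge0 => i _; exact: powR_ge0.
  have T0 : 0 <= \sum_(0 <= v < m.+1) `|b v| `^ k'.
    by apply: sumr_ge0 => i _; exact: powR_ge0.
  exact: powR_mul_le (hM m N).
have := @hardy_sum R k s k' (M `^ s) (fun v => `|b v|) (fun v => `|x v|) w N k1
  ks kk' (powR_ge0 _ _) (fun v => normr_ge0 _) (fun v => normr_ge0 _) w0 hK.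
move=> h; apply: (@le_trans _ _
  (\sum_(0 <= n < N) (w n * \sum_(0 <= v < n) `|b v| * `|x v|) `^ s)).
  apply: ler_sum_nat => n _; apply: powR_le => //; first exact: ltW.
  rewrite normrM ger0_norm// ler_wpM2l//; apply: (le_trans (ler_norm_sum _ _ _)).
  by rewrite le_eqVlt; apply/orP; left; apply/eqP; apply: eq_bigr => v _;
    rewrite normrM.
apply: (le_trans h); rewrite ler_wpM2l//.
  by rewrite !mulr_ge0 ?powR_ge0// ltW.
apply: powR_le (hZ N); first by rewrite divr_ge0// ltW.
by apply: sumr_ge0 => i _; exact: powR_ge0.
Qed.

(** The partial sums of [y] with signs chosen recursively so that the next
    term never pulls the sum towards zero. *)
Fixpoint signed_sum (R : realType) (y : nat -> R) (n : nat) : R :=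
  if n is m.+1 then
    signed_sum y m + (if 0 <= signed_sum y m then 1 else -1) * y m
  else 0.

(** Giving [x n] the sign of the sum of the previous [b v * x v] makes the two
    terms of the n-th coordinate add up in absolute value, so the diagonal term
    alone is dominated by the image sequence. *)
Lemma triangular_diag (R : realType) (k s : R) (d w b : nat -> R) :
  0 <= k -> 0 <= s -> (forall n, 0 <= d n) -> (forall n, 0 <= w n) ->
  (forall x, in_ell k x ->
    in_ell s (fun n => d n * x n + w n * \sum_(0 <= v < n) b v * x v)) ->
  forall x, (forall v, 0 <= x v) -> in_ell k x ->
    in_ell s (fun n => d n * x n).
Proof.
move=> k0 s0 d0 w0 H x x0 hx.
pose G := signed_sum (fun v => b v * x v).
pose sg n : R := if 0 <= G n then 1 else -1.
have sgN n : `|sg n| = 1 by rewrite /sg; case: ifP; rewrite ?normrN normr1.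
have GE n : \sum_(0 <= v < n) b v * (sg v * x v) = G n.
  elim: n => [|n IH]; first by rewrite big_nil.
  by rewrite big_nat_recr//= IH /G/= mulrCA.
have /H : in_ell k (fun v => sg v * x v).
  apply: in_ell_le hx => // n; by rewrite normrM sgN mul1r.
apply: in_ell_le => // n; rewrite GE ger0_norm ?mulr_ge0//.
rewrite /sg; case: ifP => [G0|/negbT].
  by rewrite mul1r ger0_norm ?lerDl ?addr_ge0 ?mulr_ge0.
rewrite -ltNge mulN1r mulrN -normrN opprD opprK -mulrN => /ltW G0.
by rewrite ger0_norm ?lerDl ?addr_ge0 ?mulr_ge0 ?oppr_ge0.
Qed.

(** Both bounds are instances of [uniform_bound]. For the diagonal the
    functionals are the coordinates [d n * x n], tested on indicators. For the
    Hardy part the functional of index (m, N) replaces the inner sums of the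
    rows m < n < N by their common part over v <= m, which is smaller once the
    signs of [b] are absorbed in [x]; it is tested on |b_v|^(k'/k), v <= m,
    normalised in l^k. *)
Lemma triangular_necessary (R : realType) (k s k' : R) (d w b : nat -> R) :
  1 < k -> k <= s -> k^-1 + k'^-1 = 1 ->
  (forall n, 0 <= d n) -> (forall n, 0 <= w n) ->
  (forall x, in_ell k x ->
    in_ell s (fun n => d n * x n + w n * \sum_(0 <= v < n) b v * x v)) ->
  (exists M, forall n, d n <= M) /\
  (exists M, forall m N, (\sum_(m.+1 <= n < N) w n `^ s) `^ s^-1 *
     (\sum_(0 <= v < m.+1) `|b v| `^ k') `^ k'^-1 <= M).
Proof.
move=> k1 ks kk' d0 w0 H.
have k0 : 0 < k by exact: lt_trans k1.
have s0 : 0 < s by exact: lt_le_trans ks.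
have k'0 : 0 < k'.
  by rewrite -invr_gt0 -(@ltrD2l _ k^-1) kk' addr0 invf_lt1.
have sV0 : 0 <= s^-1 by rewrite invr_ge0 ltW.
have hdiag : exists M, forall n, d n <= M.
  have [|||C hC] := @uniform_bound R nat k (fun n x => d n * x n) k0.
  - by move=> n x y x0 xy; exact: ler_wpM2l.
  - by move=> n c x c0; rewrite mulrCA.
  - move=> x x0 /(triangular_diag (ltW k0) (ltW s0) d0 w0 H x0)[Z hZ].
    exists (Z `^ s^-1) => n.
    rewrite -[leLHS](powRKV s0) ?mulr_ge0//; apply: powR_le; rewrite ?powR_ge0//.
    apply: le_trans (hZ n.+1).
    rewrite big_nat_recr//= ger0_norm ?mulr_ge0// lerDr.
    by apply: sumr_ge0 => i _; exact: powR_ge0.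
  exists C => n; have := hC n (fun v => (v == n)%:R) (fun v => ler0n _ _).
  rewrite eqxx mulr1; apply => N.
  have e1 : \sum_(0 <= v < n.+1) (v == n)%:R = 1 :> R.
    rewrite big_nat_recr//= eqxx big_nat big1 ?add0r//.
    by move=> v /andP[_ vn]; rewrite ltn_eqF.
  rewrite -[leRHS]e1; apply: le_trans (sum_cut N n.+1 (fun v => ler0n _ _)).
  apply: ler_sum_nat => v _.
  have [->|_] := eqVneq v n; first by rewrite ?eqxx ltnSn powR1 mulr1.
  by rewrite powR0 ?mulr0// gt_eqF.
split=> //; have [Md hd] := hdiag.
have Hhardy x : in_ell k x ->
    in_ell s (fun n => w n * \sum_(0 <= v < n) b v * x v).
  move=> hx; have hdx : in_ell s (fun n => - d n * x n).
    apply: (@in_ellM _ _ Md);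
      [exact: ltW | by move=> n; rewrite normrN ger0_norm |].
    exact: in_ell_incl hx.
  apply: in_ell_le (in_ellD (ltW s0) (H _ hx) hdx); first exact: ltW.
  by move=> n; rewrite mulNr addrAC subrr add0r.
pose W (i : nat * nat) := \sum_(i.1.+1 <= n < i.2) w n `^ s.
have W0 i : 0 <= W i by apply: sumr_ge0 => n _; exact: powR_ge0.
pose F (i : nat * nat) x := W i `^ s^-1 * \sum_(0 <= v < i.1.+1) `|b v| * x v.
have [|||C hC] := @uniform_bound R _ k F k0.
- move=> i x y x0 xy; rewrite ler_wpM2l ?powR_ge0//.
  by apply: ler_sum_nat => v _; rewrite ler_wpM2l.
- move=> i c x c0; rewrite /F [RHS]mulrCA; congr (_ * _); rewrite mulr_sumr.
  by apply: eq_bigr => v _; rewrite mulrCA.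
- move=> x x0 hx.
  pose sg v : R := if 0 <= b v then 1 else -1.
  have sgN v : `|sg v| = 1 by rewrite /sg; case: ifP; rewrite ?normrN normr1.
  have bsg v : b v * sg v = `|b v|.
    rewrite /sg; case: ifP => [/ger0_norm->|]; first by rewrite mulr1.
    by move/negbT; rewrite -ltNge => /ltr0_norm->; rewrite mulrN1.
  have /Hhardy[Z hZ] : in_ell k (fun v => sg v * x v).
    by apply: in_ell_le hx => [|v]; [exact: ltW | rewrite normrM sgN mul1r].
  exists (Z `^ s^-1) => -[m N]; rewrite /F /=.
  set S := \sum_(0 <= v < m.+1) _.
  have S0 : 0 <= S by apply: sumr_ge0 => v _; rewrite mulr_ge0.
  rewrite -[S](powRKV s0 S0) -powRM ?powR_ge0//.
  apply: powR_le; rewrite ?mulr_ge0 ?powR_ge0//.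
  apply: le_trans (hZ N).
  have [Nm|mN] := leqP N m.+1.
    rewrite /W/= big_geq// mul0r.
    by apply: sumr_ge0 => i _; exact: powR_ge0.
  rewrite [leRHS](big_cat_nat (leq0n m.+1) (ltnW mN))/=.
  apply: ler_wpDl; first by apply: sumr_ge0 => i _; exact: powR_ge0.
  rewrite /W/= mulr_suml; apply: ler_sum_nat => n /andP[mn _].
  rewrite -powRM//; apply: powR_le; rewrite ?mulr_ge0 ?(ltW s0)//.
  rewrite normrM ger0_norm// ler_wpM2l//; apply: le_trans (ler_norm _).
  rewrite (big_cat_nat (leq0n m.+1) mn)//= /S.
  rewrite (eq_bigr (fun v => b v * (sg v * x v))); last first.
    by move=> v _; rewrite mulrA bsg.
  rewrite lerDl; apply: sumr_ge0 => v _.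
  by rewrite mulrA bsg mulr_ge0.
exists C => m N.
pose B := \sum_(0 <= v < m.+1) `|b v| `^ k'.
have B0 : 0 <= B by apply: sumr_ge0 => v _; exact: powR_ge0.
have C0 : 0 <= C.
  apply: le_trans (hC (m, N) (fun=> 0) (fun=> lexx _) _).
    rewrite mulr_ge0 ?powR_ge0// sumr_ge0// => v _; by rewrite mulr0.
  by move=> n; rewrite big1// => v _; rewrite powR0// gt_eqF.
rewrite -/(W (m, N)) -/B; have [B_eq0|B_neq0] := eqVneq B 0.
  by rewrite B_eq0 (@powR0 _ k'^-1) ?mulr0// invr_eq0 gt_eqF.
have {}B0 : 0 < B by rewrite lt_def B_neq0.
(* Normalised so that the k-th powers sum to 1; since k' / k = k' - 1, the
   product of [`|b v|] and [x v] is proportional to [`|b v| `^ k']. *)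
pose x v := ((v < m.+1)%:R * (`|b v| `^ k' / B)) `^ k^-1.
have c0 v : 0 <= `|b v| `^ k' / B by rewrite divr_ge0 ?powR_ge0// ltW.
have := hC (m, N) x (fun v => powR_ge0 _ _); rewrite /F/=.
have -> : \sum_(0 <= v < m.+1) `|b v| * x v = B `^ k'^-1.
  have -> : B `^ k'^-1 = B * B `^ (- k^-1).
    rewrite -[X in X * _]powRr1 ?(ltW B0)// -gt0_powRD//; congr (_ `^ _).
    by rewrite -kk' addrAC subrr add0r.
  rewrite powRN {1}/B mulr_suml; apply: eq_big_nat => v /andP[_ vm].
  rewrite /x vm mul1r powRM ?powR_ge0 ?invr_ge0 ?(ltW B0)// mulrA -powRrM.
  congr (_ * _); last by rewrite -powRN -mulN1r powRrM powR_inv1 ?(ltW B0).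
  rewrite -[RHS]mulr_powRB1//; congr (_ * _ `^ _).
  by rewrite -[k^-1](addrK k'^-1) kk' mulrBr mulr1 divff ?gt_eqF.
apply => n; apply: (@le_trans _ _ (\sum_(0 <= v < m.+1) `|b v| `^ k' / B)).
  apply: le_trans (sum_cut n m.+1 c0).
  by apply: ler_sum_nat => v _; rewrite powRVK// mulr_ge0.
by rewrite -mulr_suml divff.
Qed.

(** * Extended real series *)

Lemma nneseries_lty (R : realType) (f : nat -> R) :
  (forall n, 0 <= f n) -> f 0 = 0 ->
  (\sum_(1 <= n <oo) (f n)%:E < +oo)%E <->
  exists Z : R, forall N, \sum_(0 <= n < N) f n <= Z.
Proof.
move=> f0 f00; have fe0 n : (0 <= (f n)%:E)%E by rewrite lee_fin.
have cut N : \sum_(0 <= n < N.+1) f n = \sum_(1 <= n < N.+1) f n.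
  by rewrite big_nat_recl//= f00 add0r big_add1.
split=> [lty|[Z hZ]].
  exists (fine (\sum_(1 <= n <oo) (f n)%:E)%E) => N.
  apply: (@le_trans _ _ (\sum_(0 <= n < N.+1) f n)).
    by rewrite big_nat_recr//= lerDl.
  rewrite cut -lee_fin fineK; last first.
    by rewrite ge0_fin_numE// nneseries_ge0// => n _ _.
  by rewrite -sumEFin; apply: nneseries_lim_ge => n _ _.
apply: le_lt_trans (ltry Z); apply: lime_le.
  by apply: is_cvg_nneseries => n _ _.
apply: nearW => -[|N].
  by have := hZ 0; rewrite !big_geq.
by rewrite sumEFin lee_fin -cut.
Qed.

(** An infinite series times [h = 0] is 0 in the extended reals, and so are all
    the products of the truncations; thus the equivalence also covers the case
    where the series diverges. *)
Lemma nneseries_powR_mul_le (R : realType) (f : nat -> R) (th h M : R) m :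
  (forall n, 0 <= f n) -> 0 < th -> 0 <= h ->
  ((\sum_(m <= n <oo) (f n)%:E) `^ th * h%:E <= M%:E)%E <->
  forall N, (\sum_(m <= n < N) f n) `^ th * h <= M.
Proof.
move=> f0 th0 h0; have fe0 n : (0 <= (f n)%:E)%E by rewrite lee_fin.
have S0 N : 0 <= \sum_(m <= n < N) f n by exact: sumr_ge0.
have E0 : (0 <= \sum_(m <= n <oo) (f n)%:E)%E by apply: nneseries_ge0 => n _ _.
split=> [hM N|hM].
  rewrite -lee_fin EFinM; apply: le_trans hM; apply: lee_wpmul2r.
    by rewrite lee_fin.
  rewrite -poweR_EFin; apply: gt0_ler_poweR; rewrite ?(ltW th0)//.
  - by rewrite in_itv/= lee_fin S0 leey.
  - by rewrite in_itv/= E0 leey.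
  - by rewrite -sumEFin; apply: nneseries_lim_ge => n _ _.
have [->|hN0] := eqVneq h 0.
  by rewrite mule0 lee_fin (le_trans _ (hM 0))// mulr_ge0// powR_ge0.
have {h0 hN0}h0 : 0 < h by rewrite lt_def hN0.
have Mh0 : 0 <= M / h.
  rewrite divr_ge0 ?(ltW h0)//; apply: le_trans (hM 0).
  by rewrite mulr_ge0 ?powR_ge0// ltW.
have le : (\sum_(m <= n <oo) (f n)%:E <= ((M / h) `^ th^-1)%:E)%E.
  apply: lime_le; first by apply: is_cvg_nneseries => n _ _.
  apply: nearW => N; rewrite sumEFin lee_fin -[leLHS](powRKV th0)//.
  apply: powR_le; rewrite ?invr_ge0 ?(ltW th0) ?powR_ge0//.
  by rewrite ler_pdivlMr.
apply: (@le_trans _ _ ((M / h)%:E * h%:E)%E); last first.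
  by rewrite -EFinM divfK ?gt_eqF.
apply: lee_wpmul2r; first by rewrite lee_fin ltW.
rewrite -[M / h](powRVK th0)// -poweR_EFin.
apply: gt0_ler_poweR; rewrite ?(ltW th0)//.
- by rewrite in_itv/= E0 leey.
- by rewrite in_itv/= lee_fin powR_ge0 leey.
Qed.

(** * Increments of weighted means *)

Lemma psumS (R : realType) (u : nat -> R) n : psum u n.+1 = psum u n + u n.+1.
Proof. by rewrite /psum big_nat_recr. Qed.

Lemma psum0 (R : realType) (u : nat -> R) : psum u 0 = u 0.
Proof. by rewrite /psum big_nat1. Qed.

Lemma psum_gt0 (R : realType) (u : nat -> R) n :
  (forall i, 0 < u i) -> 0 < psum u n.
Proof.
move=> u0; elim: n => [|n IH]; first by rewrite psum0.
by rewrite psumS addr_gt0.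
Qed.

(** As [0.-1] is [0], the increment of index 0 vanishes. *)
Definition dwmean (R : realType) (p a : nat -> R) (n : nat) : R :=
  wmean p a n - wmean p a n.-1.

Lemma dwmean0 (R : realType) (p a : nat -> R) : dwmean p a 0 = 0.
Proof. by rewrite /dwmean subrr. Qed.

Lemma mulr_wmean (R : realType) (p a : nat -> R) n : (forall i, 0 < p i) ->
  psum p n * wmean p a n = \sum_(0 <= i < n.+1) p i * psum a i.
Proof. by move=> p0; rewrite mulrA divff ?mul1r// gt_eqF// psum_gt0. Qed.

(** Obtained by solving P_(n+1) T_(n+1) - P_n T_n = p_(n+1) s_(n+1) for the
    partial sum s_(n+1), where T is the weighted mean. *)
Lemma psum_dwmean (R : realType) (p a : nat -> R) n : (forall i, 0 < p i) ->
  psum a n.+1 = wmean p a n + psum p n.+1 / p n.+1 * dwmean p a n.+1.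
Proof.
move=> p0; rewrite /dwmean /=.
have := mulr_wmean a n.+1 p0; rewrite big_nat_recr//= -mulr_wmean// psumS.
have := p0 n.+1; move: (p n.+1) (psum p n) (psum a n.+1) => pn P s pn0 h.
apply: (mulfI (lt0r_neq0 pn0)).
have -> : pn * s = (P + pn) * wmean p a n.+1 - P * wmean p a n.
  by rewrite h; ring.
by field; rewrite gt_eqF.
Qed.

Definition wmean_coef (R : realType) (p q : nat -> R) (v : nat) : R :=
  psum q v - q v * psum p v / p v.

(** Summation by parts: the coefficients [wmean_coef] are those for which both
    sides have the same increments in [n]. *)
Lemma sum_wmean_coef (R : realType) (p q a : nat -> R) n :
  (forall i, 0 < p i) ->
  \sum_(0 <= v < n.+1) wmean_coef p q v * dwmean p a v =
  psum q n * wmean p a n - \sum_(0 <= i < n.+1) q i * psum a i.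
Proof.
move=> p0; elim: n => [|n IH].
  rewrite !big_nat1 dwmean0 mulr0 !psum0 /wmean big_nat1 !psum0.
  by rewrite mulKf ?subrr// gt_eqF.
rewrite !(big_nat_recr n.+1)//= IH (psum_dwmean a n p0).
have -> : wmean p a n.+1 = wmean p a n + dwmean p a n.+1.
  by rewrite /dwmean/= addrC subrK.
rewrite /wmean_coef !(psumS q); ring.
Qed.

(** The increment of the [q]-mean is q / (Q_(n+1) Q_n) times
    Q_n s_(n+1) minus the sum of the q_i s_i for i <= n; [psum_dwmean] and
    [sum_wmean_coef] express both through the increments of the [p]-mean. *)
Lemma dwmeanE (R : realType) (p q a : nat -> R) n :
  (forall i, 0 < p i) -> (forall i, 0 < q i) ->
  dwmean q a n.+1 =
  (q n.+1 * psum p n.+1) / (p n.+1 * psum q n.+1) * dwmean p a n.+1 +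
  q n.+1 / (psum q n.+1 * psum q n) *
    \sum_(0 <= v < n.+1) wmean_coef p q v * dwmean p a v.
Proof.
move=> p0 q0; rewrite sum_wmean_coef// -mulr_wmean//.
have hs := psum_dwmean a n p0; rewrite (psum_dwmean a n q0) in hs.
have Q0 : psum q n != 0 by rewrite gt_eqF// psum_gt0.
have Q1 : psum q n.+1 != 0 by rewrite gt_eqF// psum_gt0.
have pn : p n.+1 != 0 by rewrite gt_eqF.
have qn : q n.+1 != 0 by rewrite gt_eqF.
have {hs}hs : psum q n.+1 / q n.+1 * dwmean q a n.+1 = wmean p a n - wmean q a n
    + psum p n.+1 / p n.+1 * dwmean p a n.+1.
  by rewrite -[LHS](addKr (wmean q a n)) hs; ring.
have -> : dwmean q a n.+1 = q n.+1 / psum q n.+1 *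
    (psum q n.+1 / q n.+1 * dwmean q a n.+1) by field; rewrite Q1 qn.
by rewrite hs; field; rewrite Q0 Q1 pn.
Qed.

(** The partial sums of [x] are the weighted means, [psum_dwmean] then dictates
    the partial sums of the series, and these dictate its terms. *)
Lemma dwmean_surj (R : realType) (p x : nat -> R) :
  (forall i, 0 < p i) -> x 0 = 0 -> exists a, forall n, dwmean p a n = x n.
Proof.
move=> p0 x0; pose T n := psum x n.
pose s n := T n.-1 + psum p n / p n * x n.
pose a n := if n is m.+1 then s n - s m else s 0.
have sa n : psum a n = s n.
  by elim: n => [|n IH]; rewrite ?psum0// psumS IH /= addrC subrK.
exists a; suff wT n : wmean p a n = T n.
  by case=> [|n]; rewrite ?dwmean0// /dwmean !wT /T/= psumS addrAC subrr add0r.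
apply: (mulfI (lt0r_neq0 (psum_gt0 n p0))); rewrite mulr_wmean//.
elim: n => [|n IH].
  by rewrite big_nat1 sa /s /T !psum0 x0 mulr0 addr0.
rewrite big_nat_recr//= IH sa /s /T/= !psumS.
by field; rewrite gt_eqF.
Qed.

(** The substitution X_n = n^(1-1/k) x_n turns the weight n^(k-1) into 1. *)
Lemma wm_summableE (R : realType) (p : nat -> R) (k : R) (a : nat -> R) :
  1 < k -> wm_summable p k a <->
  in_ell k (fun n => n%:R `^ (1 - k^-1) * dwmean p a n).
Proof.
move=> k1; have k0 : 0 < k by exact: lt_trans k1.
rewrite /wm_summable nneseries_lty; last 2 first.
- by move=> n; rewrite mulr_ge0 ?powR_ge0.
- by rewrite powR0 ?mul0r// subr_eq0 gt_eqF.
have e N : \sum_(0 <= n < N) `|n%:R `^ (1 - k^-1) * dwmean p a n| `^ k =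
    \sum_(0 <= n < N) n%:R `^ (k - 1) * `|wmean p a n - wmean p a n.-1| `^ k.
  apply: eq_bigr => n _; rewrite normrM powRM// ger0_norm ?powR_ge0//.
  by rewrite -powRrM mulrBl mul1r mulVf ?gt_eqF.
by split=> -[Z hZ]; exists Z => N; [rewrite e | rewrite -e].
Qed.

(** * The summability theorem *)

Definition hardy_weight (R : realType) (q : nat -> R) (s : R) (n : nat) : R :=
  n%:R `^ (1 - s^-1) * (q n / (psum q n * psum q n.-1)).

(** At [v = 0] the power of 0 with negative exponent is 0, so that sums of
    these coefficients may start at 0. *)
Definition hardy_coef (R : realType) (p q : nat -> R) (k' : R) (v : nat) : R :=
  v%:R `^ (- k'^-1) * wmean_coef p q v.

(** For [k = s] the power in [diag_quantity] is 1 at 0, so the value there is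
    set to 0 separately. *)
Definition diag_weight (R : realType) (p q : nat -> R) (k s : R) (n : nat) : R :=
  if n is 0 then 0 else diag_quantity p q k s n.

Lemma head_factorE (R : realType) (p q : nat -> R) (k' : R) m : 0 < k' ->
  head_factor p q k' m =
  (\sum_(0 <= v < m.+1) `|hardy_coef p q k' v| `^ k') `^ k'^-1.
Proof.
move=> k'0; congr (_ `^ _); have k'N0 : k' != 0 by rewrite gt_eqF.
rewrite [RHS]big_nat_recl//= [X in X + _](_ : _ = 0) ?add0r; last first.
  rewrite /hardy_coef (@powR0 _ (- _)) ?oppr_eq0 ?invr_eq0//.
  by rewrite mul0r normr0 powR0.
rewrite big_add1/=; apply: eq_bigr => v _.
rewrite /hardy_coef normrM powRM// ger0_norm ?powR_ge0// -powRrM.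
by rewrite mulNr mulVf// powR_inv1// mulrC.
Qed.

Lemma product_quantity_le (R : realType) (p q : nat -> R) (k' s M : R) m :
  0 < k' -> 0 < s ->
  (product_quantity p q k' s m <= M%:E)%E <->
  forall N, (\sum_(m.+1 <= n < N) hardy_weight q s n `^ s) `^ s^-1 *
    (\sum_(0 <= v < m.+1) `|hardy_coef p q k' v| `^ k') `^ k'^-1 <= M.
Proof.
move=> k'0 s0; rewrite /product_quantity /tail_factor head_factorE//.
apply: nneseries_powR_mul_le; rewrite ?invr_gt0 ?powR_ge0// => n.
exact: powR_ge0.
Qed.

(** [dwmeanE] in the rescaled variables: the powers of [v] in [hardy_coef]
    cancel those of the rescaled increments since 1 - 1/k = 1/k'. *)
Lemma dwmean_triangular (R : realType) (p q : nat -> R) (k s k' : R) a n :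
  (forall i, 0 < p i) -> (forall i, 0 < q i) ->
  1 < s -> k^-1 + k'^-1 = 1 -> 0 < k' ->
  n%:R `^ (1 - s^-1) * dwmean q a n =
  diag_weight p q k s n * (n%:R `^ (1 - k^-1) * dwmean p a n) +
  hardy_weight q s n * \sum_(0 <= v < n) hardy_coef p q k' v *
    (v%:R `^ (1 - k^-1) * dwmean p a v).
Proof.
move=> p0 q0 s1 kk' k'0; case: n => [|n].
  by rewrite dwmean0 big_nil !mulr0 addr0 mul0r.
have nE : n.+1%:R `^ (1 - s^-1) =
    n.+1%:R `^ (k^-1 - s^-1) * n.+1%:R `^ (1 - k^-1) :> R.
  by rewrite -gt0_powRD ?ltr0n//; congr (_ `^ _); ring.
have -> : \sum_(0 <= v < n.+1) hardy_coef p q k' v *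
    (v%:R `^ (1 - k^-1) * dwmean p a v) =
    \sum_(0 <= v < n.+1) wmean_coef p q v * dwmean p a v.
  apply: eq_bigr => -[|v] _; first by rewrite dwmean0 !mulr0.
  have kE : 1 - k^-1 = k'^-1 by rewrite -kk' addrC addKr.
  have vN0 : v.+1%:R `^ (k'^-1) != 0 :> R by rewrite gt_eqF// powR_gt0// ltr0n.
  by rewrite /hardy_coef kE powRN; field.
rewrite (dwmeanE _ _ p0 q0) mulrDr; congr (_ + _); last first.
  by rewrite /hardy_weight/= mulrA.
rewrite [in LHS]nE /diag_weight /diag_quantity.
move: (_ / (p _ * _)) => e; ring.
Qed.

Theorem mainTheorem1 (R : realType) (p q : nat -> R) (k s kstar : R)
    (p_gt0 : forall n, 0 < p n) (q_gt0 : forall n, 0 < q n)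
    (k_gt1 : 1 < k) (k_le_s : k <= s)
    (kstarE : k^-1 + kstar^-1 = 1) :
  wm_implies p k q s <->
  (exists M : R, forall n : nat, (1 <= n)%N -> diag_quantity p q k s n <= M) /\
  (exists M : R, forall m : nat, (1 <= m)%N ->
     (product_quantity p q kstar s m <= M%:E)%E).
Proof.
have s_gt1 : 1 < s by exact: lt_le_trans k_le_s.
have k_gt0 : 0 < k by exact: lt_trans k_gt1.
have s_gt0 : 0 < s by exact: lt_trans s_gt1.
have kstar_gt0 : 0 < kstar.
  by rewrite -invr_gt0 -(@ltrD2l _ k^-1) kstarE addr0 invf_lt1.
set d := diag_weight p q k s; set w := hardy_weight q s.
set b := hardy_coef p q kstar.
have P_gt0 n := psum_gt0 n p_gt0; have Q_gt0 n := psum_gt0 n q_gt0.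
have d_ge0 n : 0 <= d n.
  case: n => [|n]; first exact: lexx.
  by rewrite mulr_ge0 ?powR_ge0// divr_ge0// ltW// mulr_gt0.
have w_ge0 n : 0 <= w n.
  by rewrite mulr_ge0 ?powR_ge0// divr_ge0// ltW// mulr_gt0.
have b0 : b 0 = 0.
  by rewrite /b /hardy_coef powR0 ?mul0r// oppr_eq0 invr_eq0 gt_eqF.
have tri a n := dwmean_triangular a n p_gt0 q_gt0 s_gt1 kstarE kstar_gt0.
split=> [H|[[Md hMd] [M hM]]].
  have [|[Md hMd] [M hM]] :=
    triangular_necessary (b := b) k_gt1 k_le_s kstarE d_ge0 w_ge0.
    move=> X hX; pose x v : R := v%:R `^ (- (1 - k^-1)) * X v.
    have e0 : 1 - k^-1 != 0 by rewrite subr_eq0 eq_sym invr_eq1 gt_eqF.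
    have [|a ax] := @dwmean_surj R p x p_gt0.
      by rewrite /x powR0 ?mul0r// oppr_eq0.
    have xX v : v.+1%:R `^ (1 - k^-1) * dwmean p a v.+1 = X v.+1.
      by rewrite ax /x powRN mulVKf// gt_eqF// powR_gt0// ltr0n.
    have /H/(wm_summableE _ _ s_gt1) : wm_summable p k a.
      apply/(wm_summableE _ _ k_gt1); apply: in_ell_le hX; first exact: ltW.
      by case=> [|v]; rewrite ?xX// dwmean0 mulr0 normr0.
    apply: in_ell_le => [|n]; first exact: ltW.
    rewrite tri -/d -/w -/b.
    have -> : d n * (n%:R `^ (1 - k^-1) * dwmean p a n) = d n * X n.
      by case: n => [|n]; [rewrite !mul0r | rewrite xX].
    rewrite [X in _ <= `|_ + _ * X|](_ : _ = \sum_(0 <= v < n) b v * X v)//.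
    by apply: eq_bigr => -[|v] _; rewrite ?xX// b0 !mul0r.
  split; first by exists Md => -[|n]// _; exact: (hMd n.+1).
  exists M => m _; apply/product_quantity_le => // N; exact: hM.
have hd : exists M, forall n, d n <= M.
  exists (Num.max 0 Md) => -[|n]; first by rewrite le_max lexx.
  by rewrite le_max hMd ?orbT.
have hwb : exists M, forall m N, (\sum_(m.+1 <= n < N) w n `^ s) `^ s^-1 *
    (\sum_(0 <= v < m.+1) `|b v| `^ kstar) `^ kstar^-1 <= M.
  exists (Num.max 0 M) => -[|m] N; last first.
    have h := (product_quantity_le p q M m.+1 kstar_gt0 s_gt0).1.
    by rewrite le_max h ?orbT// hM.
  by rewrite big_nat1 b0 normr0 !powR0 ?invr_eq0 ?gt_eqF// mulr0 le_max lexx.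
move=> a /(wm_summableE _ _ k_gt1) ha; apply/(wm_summableE _ _ s_gt1).
have := triangular_sufficient k_gt1 k_le_s kstarE d_ge0 w_ge0 hd hwb ha.
by apply: in_ell_le => [|n]; [exact: ltW | rewrite tri].
Qed.
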